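(* There is a universal constant $c>0$ such that for every function $q:\mathbb{N}\to\mathbb{R}_{\ge 0}$, for every (sufficiently large) dimension $d$, and for every randomized online algorithm $A$ for $d$-dimensional online vector bin packing, there exists an instance $I$ such that \[\mathbb{E}[A(I)] \;\geq\; c\cdot \frac{d}{\log^3 d}\cdot \mathrm{OPT}(I) + q(d).\] In other words, every randomized online algorithm for vector bin packing has asymptotic competitive ratio $\Omega(d/\log^3 d)$.
   Context: In $d$-dimensional vector bin packing, an instance is a finite sequence of items $w_1,\dots,w_n$, each a vector in $[0,1]^d$. A set $S$ of items fits feasibly into one bin if $\sum_{i\in S} w_i(j)\le 1$ for every coordinate $j=1,\dots,d$. $\mathrm{OPT}(I)$ denotes the minimum number of bins into which all items of $I$ can be feasibly packed (offline). In the online version, items arrive one at a time, and upon arrival each item must be immediately and irrevocably assigned to some (possibly new) bin so that every bin remains feasible; the algorithm may be randomized. $A(I)$ denotes the number of bins used by $A$ on $I$. An algorithm is called $(\alpha,q(d))$-competitive if $\mathbb{E}[A(I)]\le \alpha\,\mathrm{OPT}(I)+q(d)$ for every instance $I$; the asymptotic competitive ratio refers to the best $\alpha$ achievable with some additive term depending only on $d$. *)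

(* Defs.v *)
From HB Require Import structures.
From mathcomp Require Import all_boot all_order all_algebra.
From mathcomp Require Import all_classical all_reals all_analysis.

Set Implicit Arguments.
Unset Strict Implicit.
Unset Printing Implicit Defensive.

Import Order.TTheory GRing.Theory Num.Theory.
Local Open Scope ring_scope.

Section VectorBinPacking.
Context (R : realType) (d : nat).

Definition item := 'I_d -> R.

Definition item0 : item := fun _ => 0.

Definition valid_item (w : item) : Prop := forall j, 0 <= w j <= 1.

Definition valid_instance (I : seq item) : Prop :=
  forall i, (i < size I)%N -> valid_item (nth item0 I i).

Definition feasible_assignment (I : seq item) (f : nat -> nat) : Prop :=
  forall (b : nat) (j : 'I_d),
    \sum_(i < size I | f i == b) (nth item0 I i) j <= 1.

Definition packable (I : seq item) (k : nat) : Prop :=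
  exists f : nat -> nat,
    (forall i, (i < size I)%N -> (f i < k)%N) /\ feasible_assignment I f.

(* OPT(I): the minimum number of bins into which I can be feasibly packed
   (defaults to 0 if I cannot be packed at all, which never happens for
   valid instances). *)
Definition OPT (I : seq item) : nat :=
  match pselect (exists k, `[< packable I k >]) with
  | left h => ex_minn h
  | right _ => 0%N
  end.

(* A deterministic online algorithm: when an item arrives, it is
   irrevocably assigned to a bin (a natural-number label; an unused label
   means a new bin), as a function of the items that arrived before it
   (in order) and of the current item.  The previous assignments are
   themselves determined by the earlier items, so this is the most general
   deterministic online rule. *)
Definition online_alg := seq item -> item -> nat.

Definition assign (A : online_alg) (I : seq item) (i : nat) : nat :=
  A (take i I) (nth item0 I i).

Definition online_feasible (A : online_alg) : Prop :=
  forall I, valid_instance I -> feasible_assignment I (assign A I).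

Definition bins_used (A : online_alg) (I : seq item) : nat :=
  size (undup [seq assign A I i | i <- iota 0 (size I)]).

End VectorBinPacking.

(* Main.v *)
(** A randomised form of the Halldorsson-Szegedy online colouring lower bound.
    Vertex [t] of a graph on [d] vertices carries a random palette that contains
    exactly one hue of each of [m] pairs (a function from ['I_m] to [bool]) and a
    hidden random index [i_t], which selects the hue of [t] in its palette.  An
    earlier vertex [s] is adjacent to [t] iff the hue of [s] is not in the palette
    of [t], so equal hues never conflict and [2m] colours suffice; each vertex is
    presented [N] times in a row, which scales the optimum to at most [2mN].
    A bin that already holds at least [L] indices can receive [t] only if the
    palette of [t] agrees with it on these indices, which has probability at most
    [2^-L]; as [2^L >= 2d], on average at most half of the items go to such bins.
    An item put into a bin with fewer than [L <= m/2] indices brings a new index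
    with probability at least [1/2], since [i_t] is independent of the choice of
    the bin.  Each bin thus accounts for [O(L)] items on average, and [d N / O(L)]
    bins are needed.  Here [L] and [m] are of order [log d], which gives even the
    ratio [d / log^2 d]; a large [N] absorbs [q d]. *)
Require Import Defs.
From HB Require Import structures.
From mathcomp Require Import all_boot all_order all_algebra.
From mathcomp Require Import all_classical all_reals all_analysis.
From mathcomp Require Import measurable_realfun zify ring lra.
Set Implicit Arguments.
Unset Strict Implicit.
Unset Printing Implicit Defensive.

Import Order.TTheory GRing.Theory Num.Theory.

(** * Counting over finite families *)

(** Used to resample one component of a uniformly random world without changing its distribution. *)
Lemma sum_bijections (X I : finType) (g : X -> I -> I) (F : I -> nat) :
  (forall x, injective (g x)) ->
  (\sum_x \sum_i F (g x i) = #|X| * \sum_i F i)%N.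
Proof.
move=> ginj; rewrite -sum_nat_const; apply: eq_bigr => x _.
by rewrite [RHS](reindex_inj (ginj x)).
Qed.

(** A member of [X] is determined by its restriction to the complement of [D]. *)
Lemma card_agree_on (I : finType) (D : {set I}) (X : {set {ffun I -> bool}}) :
  (forall f g, f \in X -> g \in X -> {in D, f =1 g}) -> #|X| * 2 ^ #|D| <= 2 ^ #|I|.
Proof.
move=> agr; rewrite -(cardsC D) addnC expnD leq_mul2r; apply/orP; right.
pose r (f : {ffun I -> bool}) := [set i in ~: D | f i].
have rinj : {in X &, injective r}.
  move=> f g fX gX /setP rfg; apply/ffunP => i.
  have [iD|iD] := boolP (i \in D); first exact: agr.
  by have := rfg i; rewrite !inE iD.
rewrite -(card_in_imset rinj) -card_powerset subset_leq_card //.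
by apply/fintype.subsetP => _ /imsetP[f _ ->]; rewrite !inE; apply/fintype.subsetP=> i; rewrite !inE => /andP[].
Qed.

(** * The randomised hue game *)

Section HueGame.

Context (n m0 : nat).
Local Notation m := m0.+1.

(* A world gives each vertex its palette and its hidden index. *)
Definition world := {ffun 'I_n -> {ffun 'I_m -> bool} * 'I_m}.

(** A hue is a pair of an index and a bit; a palette [f] consists of the hues [(i, f i)]. *)
Definition clash (w : world) (s t : 'I_n) :=
  (w t).1 (w s).2 != (w s).1 (w s).2.

(** This and the next map resample the hidden index or the palette of [t] alone when [x] or [f] is
    uniform. *)
Definition shift_index (t : 'I_n) (x : 'I_m) (w : world) : world :=
  [ffun s => if s == t then ((w s).1, ((w s).2 + x)%R) else w s].

Definition xor_palette (t : 'I_n) (f : {ffun 'I_m -> bool}) (w : world) : world :=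
  [ffun s => if s == t then ([ffun i => (w s).1 i (+) f i], (w s).2) else w s].

Lemma shift_index_inj t x : injective (shift_index t x).
Proof.
apply: (can_inj (g := shift_index t (- x)%R)) => w; apply/ffunP => s; rewrite !ffunE.
by case: eqP => // _; case: (w s) => f i /=; rewrite GRing.addrK.
Qed.

Lemma xor_palette_inj t f : injective (xor_palette t f).
Proof.
apply: (can_inj (g := xor_palette t f)) => w; apply/ffunP => s; rewrite !ffunE.
case: eqP => // _; case: (w s) => g i /=; congr (_, _); apply/ffunP => j.
by rewrite !ffunE addbK.
Qed.

(* [J] is the set of items, [vt p] the vertex of which [p] is a copy. *)
Context (J : finType) (vt : J -> 'I_n) (bin : world -> J -> nat).
(** The choice for a copy of [t] may depend on everything about earlier vertices, but on [t] only
    through its palette: the index of [t] stays hidden. *)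
Hypothesis bin_online : forall (w w' : world) p,
  (forall s : 'I_n, s < vt p -> w s = w' s) ->
  (w (vt p)).1 = (w' (vt p)).1 -> bin w p = bin w' p.
Hypothesis bin_copies : forall w p q, bin w p = bin w q -> vt p = vt q -> p = q.
Hypothesis bin_clash : forall w p q, bin w p = bin w q -> vt p < vt q ->
  ~~ clash w (vt p) (vt q).

Definition indices (w : world) (t : nat) (b : nat) : {set 'I_m} :=
  [set (w (vt q)).2 | q : J & (vt q < t) && (bin w q == b)].

Definition available (w : world) (t : 'I_n) (b : nat) :=
  [forall q, (vt q < t) && (bin w q == b) ==> ~~ clash w (vt q) t].

Lemma eq_indices (w w' : world) (t b : nat) :
  (forall s : 'I_n, s < t -> w s = w' s) -> indices w t b = indices w' t b.
Proof.
move=> ww'; have bE q : vt q < t -> bin w q = bin w' q.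
  move=> qt; apply: bin_online => [s sq|]; last by rewrite ww'.
  by apply: ww'; apply: ltn_trans qt.
apply/setP => i; apply/imsetP/imsetP => -[q]; rewrite !inE => /andP[qt qb] ->.
  by exists q; [rewrite !inE qt -bE | rewrite ww'].
by exists q; [rewrite !inE qt bE | rewrite ww'].
Qed.

(** * Items in light bins *)

Context (L : nat).
Hypothesis L_gt0 : 0 < L.
Hypothesis L_le : L.*2 <= m.
Hypothesis n_le : n.*2 <= 2 ^ L.

Definition light (w : world) p := #|indices w (vt p) (bin w p)| < L.
Definition fresh (w : world) p := (w (vt p)).2 \notin indices w (vt p) (bin w p).

Lemma card_light_fresh_bin w b :
  #|[set p | [&& bin w p == b, light w p & fresh w p]]| <= L.
Proof.
set G := [set p | _].
have [->|[p0 p0G]] := set_0Vmem G; first by rewrite cards0.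
have [p pG pmax] := arg_maxnP (fun p => val (vt p)) p0G.
have {}pG : p \in G by [].
rewrite (cardsD1 p) pG add1n.
have /and3P[/eqP pb plight _] : [&& bin w p == b, light w p & fresh w p].
  by move: pG; rewrite inE.
apply: leq_ltn_trans plight.
have lt_vt q q' : q \in G -> q' \in G -> q != q' -> vt q <= vt q' -> vt q < vt q'.
  rewrite !inE => /andP[/eqP qb _] /andP[/eqP q'b _] qq'; rewrite leq_eqVlt => /orP[/eqP e|//].
  by case/eqP: qq'; apply: (@bin_copies w); [rewrite qb q'b | apply: val_inj].
have idxin q q' : q \in G -> q' \in G -> vt q < vt q' ->
    (w (vt q)).2 \in indices w (vt q') (bin w q').
  rewrite !inE => /andP[/eqP qb _] /andP[/eqP q'b _] qq'.
  by apply: imset_f; rewrite !inE qq' qb q'b eqxx.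
have fr q : q \in G -> (w (vt q)).2 \notin indices w (vt q) (bin w q).
  by rewrite inE => /and3P[].
(* All items of [G] other than its last one [p] contribute distinct indices to
   the bin seen by [p], which is light. *)
rewrite -(card_in_imset (f := fun q => (w (vt q)).2)).
  apply/subset_leq_card/fintype.subsetP => _ /imsetP[q /setD1P[qp qG] ->].
  by apply: idxin => //; apply: lt_vt => //; apply: pmax.
move=> q q' /setD1P[_ qG] /setD1P[_ q'G] e; apply/eqP; apply: contraT => qq'.
case: (leqP (vt q) (vt q')) => h.
  by have := fr _ q'G; rewrite -e idxin // lt_vt.
by have := fr _ qG; rewrite e idxin.
Qed.

Definition nbins w := size (undup [seq bin w p | p : J]).

Lemma sum_light_fresh w : \sum_p (light w p && fresh w p : nat) <= nbins w * L.
Proof.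
have -> : \sum_p (light w p && fresh w p : nat) =
    \sum_(b <- undup [seq bin w p | p : J])
      #|[set p | [&& bin w p == b, light w p & fresh w p]]|.
  under [RHS]eq_bigr => b _ do rewrite cardsE -sum1_card big_mkcond /=.
  rewrite exchange_big /=; apply: eq_bigr => p _.
  rewrite (bigD1_seq (bin w p)) ?undup_uniq //=; last first.
    by rewrite mem_undup map_f // mem_enum.
  rewrite unfold_in /= eqxx /= big1 ?addn0; first by case: (_ && _).
  by move=> b bp; rewrite unfold_in /= eq_sym (negPf bp).
rewrite /nbins -sum1_size big_distrl /=; apply: leq_sum => b _.
by rewrite mul1n card_light_fresh_bin.
Qed.

Lemma light_shift p x w : light (shift_index (vt p) x w) p = light w p.
Proof.
have e (s : 'I_n) : s < vt p -> shift_index (vt p) x w s = w s.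
  by move=> sp; rewrite ffunE ifN //; apply: contraTneq sp => ->; rewrite ltnn.
rewrite /light (eq_indices _ e).
by congr (#|indices w _ _| < L); apply: bin_online => //; rewrite ffunE eqxx.
Qed.

(** Shifting the hidden index uniformly keeps the bin and its contents, and the new index hits the
    fewer than [L <= m / 2] present ones with probability below one half. *)
Lemma light_le p :
  \sum_w (light w p : nat) <= 2 * \sum_w (light w p && fresh w p : nat).
Proof.
rewrite -(leq_pmul2l (ltn0Sn m0)) mulnCA.
rewrite -[X in 2 * (X * _)](card_ord m).
rewrite -(sum_bijections _ (@shift_index_inj (vt p))).
rewrite exchange_big /= !big_distrr /=; apply: leq_sum => w _.
under eq_bigr => x _ do rewrite light_shift.
case: (boolP (light w p)) => [lw /=|]; last by rewrite muln0.
rewrite muln1.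
set D := indices w (vt p) (bin w p).
have -> : \sum_(x < m) (fresh (shift_index (vt p) x w) p : nat) = #|~: D|.
  have e x (s : 'I_n) : s < vt p -> shift_index (vt p) x w s = w s.
    by move=> sp; rewrite ffunE ifN //; apply: contraTneq sp => ->; rewrite ltnn.
  rewrite -sum1_card [RHS]big_mkcond [RHS](reindex_inj (@GRing.addrI _ (w (vt p)).2)) /=.
  apply: eq_bigr => x _; rewrite /fresh (eq_indices _ (e x)).
  rewrite (@bin_online _ w); first by rewrite inE ffunE eqxx /= -/D; case: (_ \in D).
  - by move=> s; apply: e.
  - by rewrite ffunE eqxx.
have := cardsC D; rewrite card_ord.
by move: lw; rewrite /light -/D => lw cD; lia.
Qed.

(** * Items in heavy bins *)

Definition heavy (w : world) (t b : nat) := L <= #|indices w t b|.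

(* The right-hand side replaces the items of [t] in heavy bins by earlier items
   [q], for which [heavy w t (bin w q)] does not depend on the palette of [t]. *)
Lemma heavy_le w t :
  \sum_(p | vt p == t) (~~ light w p : nat) <=
  \sum_(q | vt q < t) (heavy w t (bin w q) && available w t (bin w q) : nat).
Proof.
(* [e p] is an item already in the bin into which [p] is put; it determines [p]
   among the copies of [t]. *)
pose e p := odflt p [pick q | (vt q < vt p) && (bin w q == bin w p)].
have eP p : ~~ light w p -> (vt (e p) < vt p) && (bin w (e p) == bin w p).
  rewrite /light -leqNgt => h; rewrite /e; case: pickP => //= no.
  have := leq_trans L_gt0 h; rewrite card_gt0 => /set0Pn[i /imsetP[q]].
  by rewrite !inE no.
rewrite -!big_mkcondr /= !sum1dep_card.
rewrite -(card_in_imset (f := e)).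
  apply/subset_leq_card/fintype.subsetP => _ /imsetP[p /[!inE] /andP[/eqP pt pl] ->].
  have /andP[h /eqP hb] := eP p pl; rewrite -pt h hb /heavy leqNgt pl /=.
  by apply/forallP => q; apply/implyP => /andP[h1 /eqP h2]; apply: bin_clash.
move=> p p'; rewrite !inE => /andP[/eqP pt /eP/andP[_ /eqP hb]].
move=> /andP[/eqP p't /eP/andP[_ /eqP hb']] epp'.
by apply: (@bin_copies w); [rewrite -hb -hb' epp' | rewrite pt p't].
Qed.

(** The bin contents before [t] do not depend on the palette of [t]. The resampled palettes that
    keep the bin available all agree on its at least [L] indices, so they form a fraction of at most
    [2 ^ - L]. *)
Lemma heavy_available_le (t : 'I_n) q : vt q < t ->
  2 ^ L * \sum_w (heavy w t (bin w q) && available w t (bin w q) : nat) <= #|world|.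
Proof.
move=> qt.
have P0 : 0 < 2 ^ m by rewrite expn_gt0.
rewrite -(leq_pmul2l P0) mulnCA.
have cE : 2 ^ m = #|{ffun 'I_m -> bool}| by rewrite card_ffun card_bool card_ord.
rewrite {1}cE -(sum_bijections _ (@xor_palette_inj t)).
rewrite exchange_big /= big_distrr /= -[#|world|]sum1_card big_distrr /=.
apply: leq_sum => w _; rewrite muln1.
have e f (s : 'I_n) : s < t -> xor_palette t f w s = w s.
  by move=> st; rewrite ffunE ifN //; apply: contraTneq st => ->; rewrite ltnn.
have bE f r : vt r < t -> bin (xor_palette t f w) r = bin w r.
  move=> rt; apply: bin_online; last by rewrite e.
  by move=> s sr; rewrite e //; apply: ltn_trans rt.
under eq_bigr => f _ do rewrite bE // /heavy (eq_indices _ (e f)).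
case: (leqP L #|indices w t (bin w q)|) => [h /=|h]; last first.
  by rewrite big1 ?muln0.
set D := indices _ _ _ in h.
rewrite -big_mkcondr /= sum1dep_card mulnC.
apply: (leq_trans (leq_mul (leqnn _) (leq_pexp2l (isT : 0 < 2) h))).
rewrite -[X in _ <= 2 ^ X](card_ord m).
apply: card_agree_on => f g; rewrite !inE => /forallP fA /forallP gA.
move=> _ /imsetP[r /[!inE] /andP[rt rb] ->].
have := fA r; have := gA r; rewrite !bE // rt rb /= /clash !(e _ _ rt) !negbK !ffunE eqxx /= !ffunE.
by move=> /eqP <- /eqP; apply: addbI.
Qed.

(** A union bound over at most [n * #|J|] pairs of a vertex and an earlier item, with
    [2 n <= 2 ^ L]. *)
Lemma sum_heavy :
  2 * \sum_w \sum_p (~~ light w p : nat) <= #|J| * #|world|.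
Proof.
set S := \sum_w _.
have SE : S <= \sum_(t < n) \sum_(q | vt q < t) \sum_w
    (heavy w t (bin w q) && available w t (bin w q) : nat).
  under [leqRHS]eq_bigr => t _ do rewrite exchange_big /=.
  rewrite exchange_big /=; apply: leq_sum => w _.
  rewrite (partition_big vt xpredT) //=; apply: leq_sum => t _.
  exact: heavy_le.
have : 2 ^ L * S <= n * (#|J| * #|world|).
  apply: (leq_trans (leq_mul (leqnn _) SE)).
  rewrite big_distrr /= -[X in X * (_ * _)](card_ord n) -[leqRHS]sum_nat_const.
  apply: leq_sum => t _; rewrite big_distrr /= -[leqRHS]sum_nat_const big_mkcond /=.
  by apply: leq_sum => q _; case: ifP => // qt; apply: heavy_available_le.
move: S (#|J| * _) {SE} => S K.
have [n0|n_gt0] := posnP n => h.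
  by move: h; rewrite [in X in _ <= X]n0 mul0n leqn0 muln_eq0 expn_eq0 => /eqP->.
rewrite -(leq_pmul2l n_gt0); apply: leq_trans h.
by rewrite mulnA muln2 leq_mul2r n_le orbT.
Qed.

(** Heavy bins take at most half of the items on average, so the light ones, at most [2 L] per bin
    on average, make up the other half. *)
Lemma game_lower_bound : #|J| * #|world| <= 4 * L * \sum_w nbins w.
Proof.
have h1 : \sum_w \sum_p (light w p : nat) <= 2 * (L * \sum_w nbins w).
  rewrite exchange_big /=.
  apply: leq_trans (_ : \sum_p (2 * \sum_w (light w p && fresh w p : nat)) <= _).
    by apply: leq_sum => p _; apply: light_le.
  rewrite -big_distrr /= leq_mul2l /= exchange_big /= big_distrr /=.
  by apply: leq_sum => w _; rewrite mulnC sum_light_fresh.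
have h2 := sum_heavy.
have h3 : #|J| * #|world| =
    \sum_w \sum_p (light w p : nat) + \sum_w \sum_p (~~ light w p : nat).
  rewrite -big_split /= mulnC -sum_nat_const; apply: eq_bigr => w _.
  by rewrite -big_split /= -sum1_card; apply: eq_bigr => p _; case: light.
lia.
Qed.

End HueGame.

(** * Realisation of the game by vectors *)

Section Instance.
Local Open Scope ring_scope.

Context (R : realType) (d0 m0 N0 : nat).
Local Notation d := d0.+1.
Local Notation m := m0.+1.
Local Notation N := N0.+1.
Local Notation world := (world d m0).

(** Item [p] is copy [p %% N] of vertex [p %/ N]; for [p < d * N] the quotient is below [d], so
    [inord] does not fall back on its default. *)
Definition vertex (p : nat) : 'I_d := inord (p %/ N).

(* Two copies of [t] clash in coordinate [t]; a copy of [t] and one of a later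
   adjacent vertex also do, while [d] values [1/d] still fit into one bin. *)
Definition vector (w : world) (t : 'I_d) : item R d := fun j =>
  if j == t then 1 else if (j < t)%N && clash w j t then d%:R^-1 else 0.

Definition instance (w : world) : seq (item R d) :=
  mkseq (fun p => vector w (vertex p)) (d * N).

Lemma val_vertex p : (p < d * N)%N -> vertex p = (p %/ N)%N :> nat.
Proof. by move=> pN; rewrite inordK // ltn_divLR. Qed.

Lemma vertex_inj p q : (p < d * N)%N -> (q < d * N)%N ->
  vertex p = vertex q -> p = q %[mod N] -> p = q.
Proof.
move=> pN qN /(congr1 val) /=; rewrite !val_vertex // => e1 e2.
by rewrite (divn_eq p N) e1 e2 -divn_eq.
Qed.

Lemma le_vertex p q : (q < d * N)%N -> (p <= q)%N -> (vertex p <= vertex q)%N.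
Proof.
by move=> qN pq; rewrite !val_vertex ?(leq_ltn_trans pq) // leq_div2r.
Qed.

Lemma size_instance w : size (instance w) = (d * N)%N.
Proof. exact: size_mkseq. Qed.

Lemma nth_instance w p : (p < d * N)%N ->
  nth (item0 R (d:=d)) (instance w) p = vector w (vertex p).
Proof. by move=> pN; rewrite nth_mkseq. Qed.

Lemma vector_ge0 w t j : 0 <= vector w t j.
Proof. by rewrite /vector; case: eqP => // _; case: ifP => // _; rewrite invr_ge0. Qed.

Lemma vector_le1 w t j : vector w t j <= 1.
Proof.
rewrite /vector; case: eqP => // _; case: ifP => // _.
by rewrite invf_le1 ?ltr0n // ler1n.
Qed.

Lemma instance_valid w : valid_instance (instance w).
Proof.
move=> p; rewrite size_instance => pN j; rewrite nth_instance //.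
by rewrite vector_ge0 vector_le1.
Qed.

(** The hidden index of [t] enters only the vectors of later vertices. *)
Lemma eq_vector (w w' : world) (t : 'I_d) :
  (forall s : 'I_d, (s < t)%N -> w s = w' s) -> (w t).1 = (w' t).1 ->
  vector w t = vector w' t.
Proof.
move=> ww' wt; apply/funext => j; rewrite /vector; case: eqP => // _.
by case: ltnP => //= jt; rewrite /clash -wt (ww' j).
Qed.

Section SameBin.
Context (w : world) (f : nat -> nat).
Hypothesis f_feasible : feasible_assignment (instance w) f.

Lemma same_bin_le1 p q j : (p < d * N)%N -> (q < d * N)%N -> p != q ->
  f p = f q -> vector w (vertex p) j + vector w (vertex q) j <= 1.
Proof.
move=> pN qN pq fpq; have := f_feasible (f p) j.
rewrite size_instance (bigD1 (Ordinal pN)) //= nth_instance //.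
rewrite (bigD1 (Ordinal qN)) /=; last by rewrite fpq eqxx -val_eqE /= eq_sym.
rewrite nth_instance // addrA; apply: le_trans; rewrite lerDl sumr_ge0 //.
by move=> i _; rewrite nth_instance // vector_ge0.
Qed.

Lemma same_bin_vertex p q : (p < d * N)%N -> (q < d * N)%N ->
  f p = f q -> vertex p = vertex q -> p = q.
Proof.
move=> pN qN fpq vpq; apply/eqP; apply: contraT => pq.
have := same_bin_le1 (vertex p) pN qN pq fpq.
by rewrite -vpq /vector eqxx gerDl ler10.
Qed.

Lemma same_bin_clash p q : (p < d * N)%N -> (q < d * N)%N ->
  f p = f q -> (vertex p < vertex q)%N -> ~~ clash w (vertex p) (vertex q).
Proof.
move=> pN qN fpq vpq; apply/negP => cl.
have pq : p != q by apply: contraTneq vpq => ->; rewrite ltnn.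
have := same_bin_le1 (vertex p) pN qN pq fpq.
have d_gt0 : 0 < d%:R^-1 :> R by rewrite invr_gt0 ltr0n.
have vne : (vertex p == vertex q) = false.
  by apply: contraTF vpq => /eqP ->; rewrite ltnn.
by rewrite /vector eqxx vne vpq cl /= gerDl leNgt d_gt0.
Qed.

End SameBin.

(** * An offline packing by hues *)

Definition hue (w : world) (t : 'I_d) : nat := ((w t).2 * 2 + (w t).1 (w t).2)%N.

Lemma hue_clash w s t : hue w s = hue w t -> ~~ clash w s t.
Proof.
rewrite /hue /clash negbK => h.
have bE (i : nat) (b : bool) : odd (i * 2 + b) = b.
  by rewrite oddD oddM andbF oddb.
have e1 : (w s).1 (w s).2 = (w t).1 (w t).2.
  by have := congr1 odd h; rewrite !bE.
have e2 : (w s).2 = (w t).2.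
  by apply/val_inj/eqP; move: h; rewrite e1 => /addIn /eqP; rewrite eqn_pmul2r.
by rewrite e1 e2.
Qed.

(** Each hue gets [N] bins, one per copy number, so that no bin receives two copies of a vertex. *)
Definition hue_packing (w : world) (p : nat) : nat :=
  (hue w (vertex p) * N + p %% N)%N.

Lemma hue_packing_eq w p q : hue_packing w p = hue_packing w q ->
  hue w (vertex p) = hue w (vertex q) /\ p = q %[mod N].
Proof.
move=> e; split.
  have := congr1 (divn^~ N) e.
  by rewrite /hue_packing !divnMDl // !divn_small ?ltn_pmod // !addn0.
by have := congr1 (modn^~ N) e; rewrite /hue_packing !modnMDl !modn_mod.
Qed.

(** If the bin holds a copy of vertex [j], all its other items vanish in coordinate [j], having the
    same hue. Otherwise each of its at most [d] items, of distinct vertices, contributes at most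
    [1 / d]. *)
Lemma hue_packing_feasible w : feasible_assignment (instance w) (hue_packing w).
Proof.
move=> b j; rewrite size_instance.
under eq_bigr => p _ do rewrite nth_instance //.
have [/existsP[p0 /andP[/eqP p0b /eqP p0j]]|no] :=
    boolP [exists p : 'I_(d * N), (hue_packing w p == b) && (vertex p == j)].
  rewrite (bigD1 p0) ?p0b //= big1 ?addr0 ?vector_le1 // => p /andP[/eqP pb pp0].
  have [hpq mpq] : hue w (vertex p0) = hue w (vertex p) /\ p0 = p %[mod N].
    by apply: hue_packing_eq; rewrite p0b pb.
  have ne : j != vertex p.
    apply: contraNneq pp0 => jp; apply/eqP/val_inj/esym.
    by apply: (vertex_inj (ltn_ord _) (ltn_ord _)) => //; apply: etrans p0j jp.
  by rewrite /vector (negPf ne) -p0j (negPf (hue_clash hpq)) andbF.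
pose X := [set p : 'I_(d * N) | hue_packing w p == b].
apply: (@le_trans _ _ (\sum_(p in X) (d%:R^-1 : R))).
  rewrite [X in X <= _](eq_bigl (fun p => p \in X)); last by move=> p; rewrite !inE.
  apply: ler_sum => p; rewrite inE => pb; rewrite /vector ifN.
    by case: ifP => // _; rewrite invr_ge0.
  by apply: contraNneq no => ->; apply/existsP; exists p; rewrite pb eqxx.
rewrite sumr_const -[_ *+ #|_|]mulr_natl ler_pdivrMr ?ltr0n // mul1r ler_nat.
rewrite -[X in (_ <= X)%N](card_ord d) -(card_in_imset (f := fun p : 'I__ => vertex p)).
  by rewrite max_card.
move=> p q; rewrite !inE => /eqP pb /eqP qb vpq; apply/val_inj.
have [_ mpq] : hue w (vertex p) = hue w (vertex q) /\ p = q %[mod N].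
  by apply: hue_packing_eq; rewrite pb qb.
exact: (vertex_inj (ltn_ord p) (ltn_ord q)).
Qed.

Lemma OPT_instance w : (OPT (instance w) <= m.*2 * N)%N.
Proof.
(* In the default case [OPT] is 0 and the bound is trivial. *)
rewrite /OPT; case: pselect => // h; case: ex_minnP => k _; apply.
apply/asboolP; exists (hue_packing w); split; last exact: hue_packing_feasible.
move=> p _; rewrite /hue_packing.
have h1 : (hue w (vertex p) < m.*2)%N.
  by rewrite /hue; have := ltn_ord (w (vertex p)).2; case: ((w _).1 _); lia.
by have := ltn_pmod p (ltn0Sn N0); nia.
Qed.

Lemma instance_lower_bound (A : online_alg R d) (L : nat) :
  (0 < L)%N -> (L.*2 <= m)%N -> (d.*2 <= 2 ^ L)%N -> online_feasible A ->
  (d * N * #|{: world}| <= 4 * L * \sum_w bins_used A (instance w))%N.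
Proof.
move=> L_gt0 L_le d_le feasA.
pose bin w (p : 'I_(d * N)) := assign A (instance w) p.
have feas w : feasible_assignment (instance w) (assign A (instance w)).
  by apply: feasA; apply: instance_valid.
have := @game_lower_bound d m0 'I_(d * N) vertex bin _ _ _ L L_gt0 L_le d_le.
rewrite card_ord => glb; apply: leq_trans (glb _ _ _) _.
(* Every item up to [p] is a copy of an earlier vertex or of the vertex of [p], so the algorithm
   reads the same input in both worlds. *)
- move=> w w' p ww' wp; rewrite /bin /assign !nth_instance //.
  have vE q : (q <= p)%N -> vector w (vertex q) = vector w' (vertex q).
    move=> qp; have := le_vertex (ltn_ord p) qp; rewrite leq_eqVlt.
    case/orP => [/eqP/val_inj ->|qtp]; first exact: eq_vector.
    apply: eq_vector => [s sq|]; last by rewrite ww'.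
    by apply: ww'; apply: ltn_trans qtp.
  rewrite vE // /instance /mkseq -!map_take take_iota; congr (A _ _).
  apply/eq_in_map => q; rewrite mem_iota /= => qp; apply: vE.
  by move: qp; rewrite add0n => /leq_trans h; apply/ltnW/h; apply: geq_minl.
- move=> w p q bpq vpq; apply/val_inj.
  exact: (same_bin_vertex (feas w) (ltn_ord p) (ltn_ord q)).
- by move=> w p q bpq vpq; apply: (same_bin_clash (feas w) (ltn_ord p) (ltn_ord q)).
rewrite leq_mul2l; apply/orP; right; apply: leq_sum => w _.
rewrite /nbins /bins_used size_instance -val_enum_ord -map_comp.
exact: leqnn.
Qed.

End Instance.

(** * Numerical estimates *)

Section FinalEstimates.
Local Open Scope ring_scope.
Context (R : realType).

Lemma ln2_ge : 2^-1 <= ln 2 :> R.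
Proof.
have h : ln (1 + (- 2^-1)) <= - 2^-1 :> R by apply: le_ln1Dx; lra.
have e : 1 + (- 2^-1) = 2^-1 :> R by lra.
by move: h; rewrite e lnV ?posrE // lerN2.
Qed.

Lemma up_log_double_bounds (d : nat) : (64 <= d)%N ->
  let L := up_log 2 d.*2 in
  [/\ (0 < L)%N, (d.*2 <= 2 ^ L)%N, (8 * L <= d)%N & L%:R <= 3 * ln d%:R :> R].
Proof.
move=> d64 L.
have d2 : (1 < d)%N by apply: leq_trans d64.
have dL : (d.*2 <= 2 ^ L)%N by apply: up_logP.
have LE : L = (up_log 2 d).+1 by rewrite /L -mul2n up_logMp // (leq_trans _ d64).
have Ld : (2 ^ (up_log 2 d).-1 < d)%N by apply: up_log_gtn.
have L7 : (7 <= L)%N.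
  by rewrite -(@leq_exp2l 2) //; apply: leq_trans dL; rewrite -[(2 ^ 7)%N]/(64.*2) leq_double.
pose k := (L - 2)%N.
have {}Ld : (2 ^ k < d)%N by rewrite (_ : k = (up_log 2 d).-1) // /k LE; lia.
split => //; first by rewrite LE.
  have pk : (6 <= k -> 8 * k.+2 <= 2 ^ k)%N.
    by elim: k {Ld} => // k IH; rewrite leq_eqVlt => /orP[/eqP <- //|/IH]; rewrite expnS; lia.
  have -> : L = k.+2 by rewrite /k; lia.
  (* For [k <= 5] one has [8 * k.+2 <= 56 < 64 <= d]; at [k = 6] the bound [8 * k.+2 <= 2 ^ k] is an
     equality. *)
  have [k5|k6] := leqP k 5; first by lia.
  by apply: ltnW; apply: leq_ltn_trans (pk k6) Ld.
have h1 : k%:R * ln 2 <= ln d%:R :> R.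
  rewrite mulrC mulr_natr -lnXn // ler_ln ?posrE ?exprn_gt0 ?ltr0n ?(leq_trans _ d64) //.
  by rewrite -natrX ler_nat ltnW.
(* Now [k / 2 <= k * ln 2 <= ln d], and [k + 2 <= 3 * (k / 2)] since [k >= 5]. *)
have h2 := ln2_ge.
have h3 : 5 <= k%:R :> R by rewrite ler_nat /k; lia.
have h4 : L%:R = k%:R + 2 :> R by rewrite -natrD /k subnK // ltnW // (leq_trans _ L7).
rewrite h4; nra.
Qed.

(** The right-hand side is twice [d / (8 L) * N]: one half dominates the multiplicative term, the
    other is at least [N] and exceeds [q]. *)
Lemma target_lt (d L N : nat) (q : R) : (64 <= d)%N -> (0 < L)%N ->
  (8 * L <= d)%N -> L%:R <= 3 * ln d%:R :> R -> q < N%:R ->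
  144^-1 * d%:R / ln d%:R ^+ 3 * (L.*2.*2 * N)%:R + q < (d * N)%:R / (4 * L)%:R.
Proof.
move=> d64 L_gt0 Ld Lln qN.
have x2 : 2 <= ln d%:R :> R.
  have : ln (2 ^+ 6) <= ln d%:R :> R.
    rewrite ler_ln ?posrE ?exprn_gt0 ?ltr0n ?(leq_trans _ d64) //.
    by rewrite -natrX ler_nat.
  by rewrite lnXn // => h; have h' := ln2_ge; lra.
move: (ln d%:R) Lln x2 => x Lx x2.
have l0 : 0 < L%:R :> R by rewrite ltr0n.
have d0 : 8 * L%:R <= d%:R :> R by rewrite -natrM ler_nat.
have N0 : 0 <= N%:R :> R by rewrite ler0n.
have -> : (L.*2.*2 * N)%:R = 4 * L%:R * N%:R :> R.
  by rewrite -!mul2n !natrM; ring.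
rewrite !natrM; move: L%:R d%:R N%:R l0 d0 N0 qN Lx => l e n l0 e0 n0 qn lx.
have x0 : 0 < x ^+ 3 by apply: exprn_gt0; lra.
(* The constant: [4 * 8 / 144 = 2 / 9], and [2 / 9 * l ^ 2 <= 2 * x ^ 2 <= x ^ 3] by [l <= 3 x] and
   [x >= 2]. *)
have e1 : 144^-1 * e / x ^+ 3 * (4 * l) <= e / (8 * l).
  rewrite ler_pdivlMr; last by lra.
  have -> : 144^-1 * e / x ^+ 3 * (4 * l) * (8 * l) = e * ((2 / 9) * l ^+ 2 / x ^+ 3).
    by field; lra.
  apply: ler_piMr; first by lra.
  rewrite ler_pdivrMr // mul1r.
  have h : l ^+ 2 <= (3 * x) ^+ 2 by rewrite lerXn2r // nnegrE; lra.
  have h' : 0 <= x ^+ 2 * (x - 2) by rewrite mulr_ge0 ?sqr_ge0 // subr_ge0.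
  by rewrite [x ^+ 3]exprS; nra.
have e2 : 1 <= e / (8 * l) by rewrite ler_pdivlMr; lra.
have -> : e * n / (4 * l) = e / (8 * l) * n + e / (8 * l) * n by field; lra.
apply: ler_ltD; first by rewrite mulrA; apply: ler_wpM2r.
by apply: lt_le_trans qn _; apply: ler_peMl.
Qed.

End FinalEstimates.

(** * Averaging over worlds, and the conclusion *)

Local Open Scope ring_scope.

(** The averaging step of Yao's principle: a bound on the sum over [W] that holds for each outcome
    passes to the expectations, which then cannot all be below [a]. *)
Lemma exists_integral_ge (R : realType) (dO : measure_display)
    (Omega : measurableType dO) (P : probability Omega R) (W : finType)
    (f : W -> Omega -> R) (a : R) :
  (0 < #|W|)%N -> (forall w x, 0 <= f w x) ->
  (forall w, measurable_fun setT (f w)) ->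
  (forall x, a *+ #|W| <= \sum_w f w x) -> 0 <= a ->
  exists w, (a%:E <= \int[P]_x (f w x)%:E)%E.
Proof.
move=> W_gt0 f_ge0 mf af a_ge0.
have mfE w : measurable_fun setT (EFin \o f w).
  exact/measurable_EFinP.
apply/not_existsP => lta.
have le_sum : ((a *+ #|W|)%:E <= \sum_w \int[P]_x (f w x)%:E)%E.
  rewrite -ge0_integral_sum //; last by move=> w x _; rewrite lee_fin.
  have -> : ((a *+ #|W|)%:E = \int[P]_x (cst (a *+ #|W|)%:E x))%E.
    rewrite integral_cst // [X in (_ * X)%E](_ : _ = 1%E) ?mule1 //.
    exact: (probability_setT P).
  apply: ge0_le_integral => //.
  - by move=> x _; rewrite lee_fin mulrn_wge0.
  - exact: emeasurable_sum.
  - by move=> x _; rewrite sumEFin lee_fin.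
have ltE w : (\int[P]_x (f w x)%:E < a%:E)%E.
  by rewrite ltNge; apply/negP/lta.
(* Being below [a], the integrals are finite, so the strict inequalities can be summed in [R]. *)
have fin w : (\int[P]_x (f w x)%:E \is a fin_num)%E.
  by rewrite ge0_fin_numE ?(lt_trans (ltE w)) ?ltry // integral_ge0 // => x _; rewrite lee_fin.
have /card_gt0P[w0 _] := W_gt0.
suff : \sum_w fine (\int[P]_x (f w x)%:E) < a *+ #|W|.
  rewrite ltNge => /negP; apply; rewrite -lee_fin -sumEFin.
  by under eq_bigr => w _ do rewrite fineK //.
rewrite -sumr_const; apply: ltr_sum; first by apply/hasP; exists w0 => //; rewrite mem_index_enum.
by move=> w _; rewrite -lte_fin fineK.
Qed.

Theorem theorem1 (R : realType) :
  exists2 c : R, 0 < c &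
  forall q : nat -> R, (forall n, 0 <= q n) ->
  exists d0 : nat, forall d : nat, (d0 <= d)%N ->
  forall (dO : measure_display) (Omega : measurableType dO)
         (P : probability Omega R) (A : Omega -> online_alg R d),
    (forall w, online_feasible (A w)) ->
    (forall I, valid_instance I ->
       measurable_fun setT (fun w => (bins_used (A w) I)%:R : R)) ->
    exists I : seq (item R d), valid_instance I /\
      ((c * d%:R / (ln d%:R) ^+ 3 * (OPT I)%:R + q d)%:E
         <= \int[P]_w ((bins_used (A w) I)%:R)%:E)%E.
Proof.
exists 144^-1; first by rewrite invr_gt0.
move=> q q_ge0; exists 64%N => -[//|d0] d64 dO Omega P A feasA mA.
set d := d0.+1 in d64 A feasA mA *.
have [L_gt0 dL Ld Lln] := up_log_double_bounds R d64.
set L := up_log 2 d.*2 in L_gt0 dL Ld Lln.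
(* Only the number of copies depends on [q]; the threshold 64 does not. *)
have [N0 qN] : exists N0 : nat, q d < N0.+1%:R.
  by exists (Num.bound (q d)); apply: lt_trans (archi_boundP (q_ge0 d)) _; rewrite ltr_nat.
(* The number of pairs is [m = 2 L], the least value with [L.*2 <= m], which gives
   [OPT <= 4 L N]. *)
pose m0 := L.*2.-1.
have mE : m0.+1 = L.*2 by rewrite /m0 prednK // double_gt0.
have tlt := target_lt d64 L_gt0 Ld Lln qN.
have x_ge0 : 0 <= ln d%:R :> R by rewrite ln_ge0 // ler1n.
pose W := world d m0.
have W_gt0 : (0 < #|{: W}|)%N.
  by apply/card_gt0P; exists [ffun=> ([ffun=> false], ord0)].
have [w hw] : exists w : W,
    (((d * N0.+1)%:R / (4 * L)%:R)%:E
      <= \int[P]_x ((bins_used (A x) (instance R N0 w))%:R)%:E)%E.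
  apply: exists_integral_ge => //.
  - by move=> w; apply: mA; apply: instance_valid.
  - move=> x; rewrite -[_ / _ *+ _]mulr_natr mulrAC ler_pdivrMr ?ltr0n ?muln_gt0 //.
    rewrite -natr_sum -!natrM ler_nat [leqRHS]mulnC.
    by apply: instance_lower_bound => //; rewrite mE.
exists (instance R N0 w); split; first exact: instance_valid.
apply: le_trans hw; rewrite lee_fin; apply: le_trans (ltW tlt).
rewrite lerD2r ler_wpM2l //.
  by rewrite divr_ge0 ?exprn_ge0 // mulr_ge0.
by rewrite ler_nat -mE; apply: OPT_instance.
Qed.
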